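(* Let $N\geq 1$ and $K\geq N$ be integers, and set $C=\left\lfloor \frac{K-1}{K+1-N}\right\rfloor+1$. Let $$W_{K,N}=\{[0;d_1,d_2,\ldots]_N\in[0,1]\setminus\mathbb{Q}\,:\, d_n\geq K\text{ for all }n\geq 1\}.$$ Then the following hold. (1) For all $x\in W_{K,N}$ the dual NCF sequence $\widehat{\omega}(x,N)$ is $C$-balanced. (2) For all $x\in W_{K,N}$ the NCF sequence $\omega(x,N)$ is $N\cdot C$-balanced.
   Context: Let $N\ge 1$ be an integer and define $T_N:[0,1]\to[0,1]$ by $T_N(x)=\frac{N}{x}-\lfloor\frac{N}{x}\rfloor$ for $x\ne0$ and $T_N(0)=0$. For $x\in[0,1]\setminus\mathbb{Q}$ the (greedy) NCF digits of $x$ are $d_n=\lfloor N/T_N^{n-1}(x)\rfloor$, $n\ge1$; they satisfy $d_n\ge N$, and one writes $x=[0;d_1,d_2,\ldots]_N=\cfrac{N}{d_1+\cfrac{N}{d_2+\cdots}}$. Every integer sequence $(d_n)_{n\geq 1}$ with $d_n\ge N$ occurs for exactly one irrational $x\in[0,1]$. A substitution on $\{0,1\}$ is given by images of the letters (nonempty words) and extends to finite words and to infinite words in $\{0,1\}^{\mathbb{N}}$ by concatenation. For $x=[0;d_1,d_2,\ldots]_N$ irrational let $\sigma_n(0)=0^{d_n}1^N$, $\sigma_n(1)=0$ and $\widehat\sigma_n(0)=0^{d_n}1$, $\widehat\sigma_n(1)=0^N$ for $n\ge1$. The NCF sequence $\omega(x,N)\in\{0,1\}^{\mathbb N}$ is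 the unique infinite word $\omega$ for which there exist $\omega^{(1)},\omega^{(2)},\ldots\in\{0,1\}^{\mathbb{N}}$ with $\omega^{(1)}=\omega$ and $\omega^{(n)}=\sigma_n(\omega^{(n+1)})$ for all $n\ge1$. The dual NCF sequence $\widehat\omega(x,N)$ is defined in the same way with $\widehat\sigma_n$ in place of $\sigma_n$. For a finite word $u$, $|u|$ is its length and $|u|_a$ the number of occurrences of the letter $a$ in $u$. A sequence $\nu\in\{0,1\}^{\mathbb{N}}$ is $C$-balanced ($C>0$) if for all finite factors (contiguous subwords) $u,v$ of $\nu$ with $|u|=|v|$ one has $-C\le|u|_a-|v|_a\le C$ for every letter $a$. *)

(* Defs.v *)
From mathcomp Require Import all_boot all_order all_algebra.
From mathcomp Require Import all_classical all_reals.

Set Implicit Arguments.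
Unset Strict Implicit.
Unset Printing Implicit Defensive.

Import Order.TTheory GRing.Theory Num.Theory.

Local Open Scope classical_set_scope.
Local Open Scope ring_scope.

(** * Words over {0,1}; [false] stands for the letter 0 and [true] for 1. *)

Definition word := seq bool.
Definition inf_word := nat -> bool.
Definition substitution := bool -> word.

Definition is_factor (u : word) (nu : inf_word) : Prop :=
  exists i : nat, u = mkseq (fun j => nu (i + j)%N) (size u).

Definition balanced (C : nat) (nu : inf_word) : Prop :=
  forall u v : word, is_factor u nu -> is_factor v nu -> size u = size v ->
  forall a : bool,
    - C%:Z <= (count_mem a u)%:Z - (count_mem a v)%:Z <= C%:Z.

Definition subst_word (s : substitution) (u : word) : word :=
  flatten (map s u).

(** When the images of the letters are nonempty, the image of a prefix of
    length [i.+1] has length at least [i.+1], and therefore determines the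
    letter of index [i] of the infinite concatenation s(w_0) s(w_1) ... *)
Definition subst_inf_word (s : substitution) (w : inf_word) : inf_word :=
  fun i => nth false (subst_word s (mkseq w i.+1)) i.

(** Indices start at 0: [sigma n] and [ws n] are the substitution and the
    word usually written with index n+1. *)
Definition is_s_adic_word (sigma : nat -> substitution) (w : inf_word) : Prop :=
  exists ws : nat -> inf_word,
    ws 0%N = w /\ forall n, ws n = subst_inf_word (sigma n) (ws n.+1).

(** The default value (the constant word 0) is irrelevant for the sequences
    of substitutions considered here: see [ncf_wordP] and [dual_ncf_wordP]. *)
Definition s_adic_word (sigma : nat -> substitution) : inf_word :=
  xget (fun=> false) [set w | is_s_adic_word sigma w].

(** * N-continued fractions *)

Section NCF.
Variables (R : realType) (N : nat).

Definition ncf_map (x : R) : R :=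
  if x == 0 then 0 else N%:R / x - (Num.floor (N%:R / x))%:~R.

(** [ncf_digit x n] is d_{n+1}. *)
Definition ncf_digit (x : R) (n : nat) : int :=
  Num.floor (N%:R / iter n ncf_map x).

Definition ncf_W (K : nat) : set R :=
  [set x | [/\ 0 <= x <= 1, irrational x & forall n, K%:Z <= ncf_digit x n]].

Definition ncf_subst (d : nat) : substitution :=
  fun a => if a then [:: false] else nseq d false ++ nseq N true.

Definition dual_ncf_subst (d : nat) : substitution :=
  fun a => if a then nseq N false else rcons (nseq d false) true.

(** The digits are nonnegative ([ncf_digit_ge]), so the absolute value
    only converts them to natural numbers. *)
Definition ncf_word (x : R) : inf_word :=
  s_adic_word (fun n => ncf_subst `|ncf_digit x n|%N).

Definition dual_ncf_word (x : R) : inf_word :=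
  s_adic_word (fun n => dual_ncf_subst `|ncf_digit x n|%N).

End NCF.

(** * Existence and uniqueness of the (dual) NCF sequence *)

Section SAdic.
Local Open Scope nat_scope.
Variable sigma : nat -> substitution.
Hypothesis sigma_head : forall n a, exists r, sigma n a = false :: r.
Hypothesis sigma_size : forall n, 1 < size (sigma n false).

Let S n u := subst_word (sigma n) u.

Let S_cat n u v : S n (u ++ v) = S n u ++ S n v.
Proof. by rewrite /S /subst_word map_cat flatten_cat. Qed.

Let S_size n u : size u <= size (S n u).
Proof.
elim: u => //= a u IH; rewrite /S /subst_word /= size_cat.
have [r ->] := sigma_head n a.
by rewrite /= addSn ltnS (leq_trans IH) // leq_addl.
Qed.

Let mkseq_prefix (w : inf_word) k l : k <= l ->
  exists v, mkseq w l = mkseq w k ++ v.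
Proof.
move=> kl; exists (drop k (mkseq w l)).
by rewrite -[LHS](cat_take_drop k) /mkseq -map_take take_iota (minn_idPl kl).
Qed.

Let nth_S n (w : inf_word) k i : i < size (S n (mkseq w k)) ->
  nth false (S n (mkseq w k)) i = subst_inf_word (sigma n) w i.
Proof.
move=> ik; rewrite /subst_inf_word -/(S n (mkseq w i.+1)).
have ii : i < size (S n (mkseq w i.+1)).
  by apply: leq_trans (S_size _ _); rewrite size_mkseq.
have [kl|/ltnW kl] := leqP k i.+1.
  by have [v ->] := mkseq_prefix w kl; rewrite S_cat nth_cat ik.
by have [v ->] := mkseq_prefix w kl; rewrite S_cat nth_cat ii.
Qed.

Let P := fix P m n : word := if m is m'.+1 then S n (P m' n.+1) else [:: false].

Let P_head m n : exists r, P m n = false :: r.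
Proof.
elim: m n => [|m IH] n /=; first by exists [::].
have [r ->] := IH n.+1; have [r' e] := sigma_head n false.
by exists (r' ++ S n r); rewrite /S /subst_word /= e.
Qed.

Let P_size m n : m < size (P m n).
Proof.
elim: m n => [//|m IH] n /=; have := IH n.+1; have [r ->] := P_head m n.+1.
rewrite /S /subst_word /= size_cat ltnS => mr.
have := leq_add (sigma_size n) (leq_trans mr (S_size n r)).
by rewrite /S /subst_word; apply: leq_trans.
Qed.

Let P_prefix1 m n : exists v, P m.+1 n = P m n ++ v.
Proof.
elim: m n => [|m IH] n.
  have [r e] := sigma_head n false.
  by exists r; rewrite /= /S /subst_word /= e cats0.
by have [v e] := IH n.+1; exists (S n v); rewrite -S_cat -e.
Qed.

Let P_prefix m l n : m <= l -> exists v, P l n = P m n ++ v.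
Proof.
move/subnK <-; elim: (l - m) => [|k [v e]]; first by exists [::]; rewrite cats0.
by have [v' e'] := P_prefix1 (k + m) n; exists (v ++ v'); rewrite catA -e -e'.
Qed.

Let W n : inf_word := fun i => nth false (P i n) i.

Let nth_P m n i : i < size (P m n) -> nth false (P m n) i = W n i.
Proof.
move=> im; rewrite /W; have ii := P_size i n.
have [kl|/ltnW kl] := leqP m i.
  by have [v ->] := P_prefix n kl; rewrite nth_cat im.
by have [v ->] := P_prefix n kl; rewrite nth_cat ii.
Qed.

Let W_fix n : W n = subst_inf_word (sigma n) (W n.+1).
Proof.
apply/funext => i.
have e : P i.+1 n.+1 = mkseq (W n.+1) (size (P i.+1 n.+1)).
  apply: (@eq_from_nth _ false); first by rewrite size_mkseq.
  by move=> j jP; rewrite nth_mkseq // nth_P.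
have iS : i < size (P i.+2 n) by apply: ltnW; apply: ltnW; apply: P_size.
rewrite -(@nth_P i.+2) // -(@nth_S _ _ (size (P i.+1 n.+1))) -e //.
Qed.

Let ws_P (ws : nat -> inf_word) :
  (forall n, ws n = subst_inf_word (sigma n) (ws n.+1)) ->
  forall m n i, i < size (P m n) -> ws n i = nth false (P m n) i.
Proof.
move=> wsE; elim=> [|m IH] n i /=.
  case: i => // _; rewrite wsE /subst_inf_word /subst_word /=.
  by have [r ->] := sigma_head n (ws n.+1 0).
have e : P m n.+1 = mkseq (ws n.+1) (size (P m n.+1)).
  apply: (@eq_from_nth _ false); first by rewrite size_mkseq.
  by move=> j jP; rewrite nth_mkseq // -IH.
by rewrite e => iS; rewrite nth_S // -wsE.
Qed.

Lemma s_adic_word_exists_unique : exists! w, is_s_adic_word sigma w.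
Proof.
exists (W 0); split; first by exists W.
move=> _ [ws [<- wsE]]; apply/funext => i.
by rewrite (ws_P wsE (P_size i 0)).
Qed.

Lemma s_adic_wordP w : is_s_adic_word sigma w <-> w = s_adic_word sigma.
Proof.
have [w0 [w0P w0U]] := s_adic_word_exists_unique.
have sP : is_s_adic_word sigma (s_adic_word sigma).
  exact: (@xgetPex _ _ [set w | is_s_adic_word sigma w]
            (ex_intro _ w0 w0P)).
by split=> [wP|->//]; rewrite -(w0U _ wP) -(w0U _ sP).
Qed.

End SAdic.

Section NCFTheory.
Variables (R : realType) (N : nat).
Hypothesis N_gt0 : (0 < N)%N.

Lemma ncf_map_irrational (x : R) : irrational x ->
  0 <= ncf_map N x <= 1 /\ irrational (ncf_map N x).
Proof.
move=> irx; have x0 : x != 0.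
  by apply/eqP => x0; apply: irx; exists 0 => //; rewrite raddf0 x0.
rewrite /ncf_map (negPf x0); split.
  rewrite subr_ge0 floor_le //= lerBlDl.
  by have := floorD1_gt (N%:R / x); rewrite intrD => /ltW.
move=> [q _ qE]; apply: irx.
exists (N%:R / (q + (Num.floor (N%:R / x))%:~R)) => //.
rewrite fmorph_div /= rmorphD /= ratr_nat ratr_int qE subrK.
by rewrite invfM invrK mulrA divff ?mul1r // pnatr_eq0 -lt0n.
Qed.

Lemma ncf_digit_ge (x : R) n : 0 <= x <= 1 -> irrational x ->
  N%:Z <= ncf_digit N x n.
Proof.
move=> x01 irx.
have [] : 0 <= iter n (ncf_map N) x <= 1 /\ irrational (iter n (ncf_map N) x).
  elim: n => [//|n [b i]] /=; exact: ncf_map_irrational.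
rewrite /ncf_digit; move: (iter _ _ _) => y /andP[y0 y1] iry.
have {}y0 : 0 < y.
  rewrite lt_neqAle y0 andbT; apply/eqP => y0'; apply: iry.
  by exists 0 => //; rewrite raddf0 y0'.
by rewrite floor_ge_int ler_pdivlMr // ler_piMr.
Qed.

Lemma ncf_wordP (x : R) (w : inf_word) : 0 <= x <= 1 -> irrational x ->
  is_s_adic_word (fun n => ncf_subst N `|ncf_digit N x n|%N) w <->
  w = ncf_word N x.
Proof.
move=> x01 irx.
have d_gt0 n : (0 < `|ncf_digit N x n|)%N.
  rewrite absz_gt0 gt_eqF // (lt_le_trans _ (ncf_digit_ge n x01 irx)) //.
apply: s_adic_wordP => n; last first.
  by rewrite /= size_cat !size_nseq (leq_add (d_gt0 n) N_gt0).
case; rewrite /ncf_subst; first by exists [::].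
by rewrite -(prednK (d_gt0 n)) /=; eexists.
Qed.

Lemma dual_ncf_wordP (x : R) (w : inf_word) : 0 <= x <= 1 -> irrational x ->
  is_s_adic_word (fun n => dual_ncf_subst N `|ncf_digit N x n|%N) w <->
  w = dual_ncf_word N x.
Proof.
move=> x01 irx.
have d_gt0 n : (0 < `|ncf_digit N x n|)%N.
  rewrite absz_gt0 gt_eqF // (lt_le_trans _ (ncf_digit_ge n x01 irx)) //.
apply: s_adic_wordP => n; last by rewrite /= size_rcons size_nseq ltnS d_gt0.
case; rewrite /dual_ncf_subst.
  by rewrite -(prednK N_gt0) /=; eexists.
by rewrite -(prednK (d_gt0 n)) /=; eexists.
Qed.

End NCFTheory.

(* Main.v *)
(** The dual word is handled by desubstitution.  Call factors u, v of a word an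
    unbalanced pair if u has at least C+1 more ones than v and v at least C+1
    more zeros than u; cutting the longer of the two shows that this only
    happens if two factors of the smaller length violate C-balance.  If u, v are
    factors of sigma(w), sigma(0) = 0^d 1, sigma(1) = 0^N, with the same length
    and such that u has at least C+1 more ones than v, then cutting u and
    extending v to blocks of sigma gives factors u', v' of w, the ones of
    u, v being in bijection with the zeros of u', v'.  Comparing lengths and
    using N C + d <= (d+1) C shows that (v', u') is again an unbalanced pair,
    and u' is shorter than u.

    The NCF word is the image of its dual under phi(0) = 0, phi(1) = 1^N, as
    phi intertwines the two families of substitutions. *)

Require Import Defs.
From mathcomp Require Import all_boot all_order all_algebra.
From mathcomp Require Import all_classical all_reals.
From mathcomp Require Import zify.

Set Implicit Arguments.
Unset Strict Implicit.
Unset Printing Implicit Defensive.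

Import Order.TTheory GRing.Theory Num.Theory.

(** * Prefix counts *)

Definition prefix_count (a : bool) (w : inf_word) (n : nat) : nat :=
  count_mem a (mkseq w n).

Lemma mkseq_add T (f : nat -> T) m n :
  mkseq f (m + n) = mkseq f m ++ mkseq (fun j => f (m + j)) n.
Proof.
by rewrite /mkseq iotaD map_cat add0n -[in iota m n](addn0 m) iotaDl -map_comp.
Qed.

Lemma count_mem_bool (u : word) :
  count_mem true u + count_mem false u = size u.
Proof.
rewrite -(count_predC (pred1 true) u); congr (_ + _).
by apply: eq_count => -[].
Qed.

Lemma prefix_count_bool w n :
  prefix_count true w n + prefix_count false w n = n.
Proof. by rewrite /prefix_count count_mem_bool size_mkseq. Qed.

Lemma prefix_countS a w n :
  prefix_count a w n.+1 = prefix_count a w n + (w n == a).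
Proof. by rewrite /prefix_count mkseqS -cats1 count_cat /= addn0. Qed.

Lemma leq_prefix_count a w m n :
  m <= n -> prefix_count a w m <= prefix_count a w n.
Proof.
by move/subnKC <-; rewrite /prefix_count mkseq_add count_cat leq_addr.
Qed.

Lemma factor_count a u w : is_factor u w -> exists i,
  prefix_count a w (i + size u) = prefix_count a w i + count_mem a u.
Proof.
by case=> i ui; exists i; rewrite /prefix_count mkseq_add count_cat -ui.
Qed.

(** Counting the letter 1 suffices: windows of equal length differ by opposite amounts in the two
    letters. Exchanging [i] and [j] gives the other bound, and sums avoid truncated subtraction. *)
Definition window_balanced (C l : nat) (w : inf_word) : Prop :=
  forall i j, prefix_count true w (i + l) + prefix_count true w j <=
              prefix_count true w (j + l) + prefix_count true w i + C.

Lemma balanced_windows C w : (forall l, window_balanced C l w) -> balanced C w.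
Proof.
move=> wb u v uw vw uv a.
have [i ui] := factor_count true uw; have [j vj] := factor_count true vw.
have := wb (size u) i j; have := wb (size u) j i.
rewrite uv vj -uv ui.
have := count_mem_bool u; have := count_mem_bool v.
by case: a; lia.
Qed.

(** If the window at [i] is the shorter, cutting the other one only lowers its ones; otherwise
    cutting the window at [i] only lowers its zeros. The common length is the minimum, so one length
    below [n] is enough. *)
Lemma unbalanced_pair C w n i i' j j' :
  (forall l, l < n -> window_balanced C l w) -> i' - i < n \/ j' - j < n ->
  i <= i' -> j <= j' ->
  prefix_count true w j' + prefix_count true w i + C < 
    prefix_count true w i' + prefix_count true w j ->
  prefix_count false w i' + prefix_count false w j + C <
    prefix_count false w j' + prefix_count false w i ->
  False.
Proof.
move=> wb sn ii jj ones zeros.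
have pc := prefix_count_bool w.
have [le_ij|lt_ji] := leqP (i' - i) (j' - j).
  have := wb (i' - i) ltac:(lia) i j; rewrite subnKC //.
  have := @leq_prefix_count true w (j + (i' - i)) j' ltac:(lia); lia.
have := wb (j' - j) ltac:(lia) i j; rewrite (subnKC jj).
have := @leq_prefix_count false w (i + (j' - j)) i' ltac:(lia).
by move: (pc i) (pc i') (pc j) (pc j') (pc (i + (j' - j))); lia.
Qed.

(** * Prefixes of substituted words *)

Lemma subst_word_cat s u v :
  subst_word s (u ++ v) = subst_word s u ++ subst_word s v.
Proof. by rewrite /subst_word map_cat flatten_cat. Qed.

Section Substitution.
Variable s : substitution.
Hypothesis s_gt0 : forall a, 0 < size (s a).

Lemma size_subst_word u : size u <= size (subst_word s u).
Proof.
elim: u => //= a u IH; rewrite /subst_word /= size_cat.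
exact: leq_add (s_gt0 a) IH.
Qed.

Lemma mkseq_subst_inf_word w n :
  mkseq (subst_inf_word s w) (size (subst_word s (mkseq w n))) =
  subst_word s (mkseq w n).
Proof.
apply: (@eq_from_nth _ false); rewrite size_mkseq // => i i_lt.
rewrite nth_mkseq // /subst_inf_word.
have i_lt' : i < size (subst_word s (mkseq w i.+1)).
  by apply: leq_trans (size_subst_word _); rewrite size_mkseq.
case: (leqP n i.+1) => [/subnKC e|/ltnW/subnKC e].
  by rewrite -e mkseq_add subst_word_cat nth_cat i_lt.
by rewrite -[in RHS]e mkseq_add subst_word_cat nth_cat i_lt'.
Qed.

Lemma prefix_subst_inf_word w i : exists m r, r < size (s (w m)) /\
  mkseq (subst_inf_word s w) i = subst_word s (mkseq w m) ++ take r (s (w m)).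
Proof.
elim: i => [|i [m [r [r_lt IH]]]].
  by exists 0, 0; rewrite s_gt0 take0.
have e : subst_word s (mkseq w m.+1) = subst_word s (mkseq w m) ++ s (w m).
  by rewrite mkseqS -cats1 subst_word_cat {2}/subst_word /= cats0.
have i_eq : i = size (subst_word s (mkseq w m)) + r.
  by rewrite -(size_mkseq (subst_inf_word s w) i) IH size_cat size_takel // ltnW.
have := mkseq_subst_inf_word w m.+1; rewrite e size_cat.
(* The next letter either stays strictly inside the current block or completes it; in the latter
   case the remainder resets to 0. *)
have [r_lt'|r_ge] := ltnP r.+1 (size (s (w m))) => [|E].
  move/(congr1 (take i.+1)); rewrite i_eq -addnS take_cat ltnNge leq_addr addKn /=.
  rewrite -(subnKC (ltnW r_lt')) addnA mkseq_add take_size_cat ?size_mkseq // => ->.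
  by exists m, r.+1.
exists m.+1, 0; rewrite s_gt0 take0 cats0 e; split=> //.
by rewrite -E i_eq -addnS; congr (mkseq _ (_ + _)); apply/eqP; rewrite eqn_leq r_lt.
Qed.

End Substitution.

Lemma subst_inf_word_comp s t w : (forall a, 0 < size (s a)) ->
  (forall a, 0 < size (t a)) ->
  subst_inf_word s (subst_inf_word t w) =
  subst_inf_word (fun a => subst_word s (t a)) w.
Proof.
move=> s_gt0 t_gt0; apply/funext => i; rewrite {1 3}/subst_inf_word.
have -> u : subst_word (fun a => subst_word s (t a)) u =
            subst_word s (subst_word t u).
  elim: u => // a u IH.
  by rewrite -[RHS]/(subst_word s (t a ++ subst_word t u)) subst_word_cat -IH.
rewrite -(mkseq_subst_inf_word t_gt0).
set k := size _; have ik : i.+1 <= k.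
  by rewrite -[leqLHS](size_mkseq w); apply: size_subst_word.
rewrite -[in RHS](subnKC ik) mkseq_add subst_word_cat nth_cat.
rewrite (leq_trans _ (size_subst_word _ _)) ?size_mkseq //.
Qed.

(** * The dual substitution *)

Lemma count_nseq_bool (a b : bool) n : count_mem a (nseq n b) = (b == a) * n.
Proof. by rewrite count_nseq. Qed.

Lemma dual_ncf_subst_gt0 N d a : 0 < N -> 0 < size (dual_ncf_subst N d a).
Proof. by case: a => ?; rewrite /= ?size_rcons size_nseq. Qed.

Lemma size_dual_ncf_subst_prefix N d w m :
  size (subst_word (dual_ncf_subst N d) (mkseq w m)) =
  d.+1 * prefix_count false w m + N * prefix_count true w m.
Proof.
elim: m => [|m IH]; first by rewrite /prefix_count /= !muln0.
rewrite mkseqS -cats1 subst_word_cat size_cat IH !prefix_countS.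
by case: (w m); rewrite /= /subst_word /= cats0 ?size_rcons size_nseq; lia.
Qed.

Lemma count_dual_ncf_subst_prefix N d w m :
  count_mem true (subst_word (dual_ncf_subst N d) (mkseq w m)) =
  prefix_count false w m.
Proof.
elim: m => [|m IH] //.
rewrite mkseqS -cats1 subst_word_cat count_cat IH !prefix_countS.
case: (w m); rewrite /= /subst_word /= cats0 ?count_nseq_bool //.
by rewrite -cats1 count_cat count_nseq_bool.
Qed.

(** Each 1 ends an image of 0, so the ones count completed images of 0. A cut inside 0^N can be
    moved to either end without meeting a 1; a cut inside 0^d 1 can only be moved back, which costs
    the error [d]. *)
Lemma desubstitute_dual N d w i : 0 < N ->
  let ones := prefix_count true (subst_inf_word (dual_ncf_subst N d) w) i in
  let len m := d.+1 * prefix_count false w m + N * prefix_count true w m in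
  (exists2 m, prefix_count false w m = ones & len m <= i) /\
  (exists2 m, prefix_count false w m = ones & i <= len m + d).
Proof.
move=> N_gt0 ones len.
have [a|m [r [r_lt E]]] := @prefix_subst_inf_word (dual_ncf_subst N d) _ w i.
  exact: dual_ncf_subst_gt0.
have onesE : ones = prefix_count false w m.
  rewrite /ones /prefix_count E count_cat count_dual_ncf_subst_prefix.
  rewrite -[RHS]addn0; congr (_ + _).
  move: r_lt; case: (w m) => /=.
    by rewrite size_nseq => /ltnW ?; rewrite take_nseq // count_nseq_bool.
  rewrite size_rcons size_nseq ltnS => rd.
  by rewrite -cats1 takel_cat ?size_nseq // take_nseq // count_nseq_bool.
have iE : i = len m + r.
  rewrite -(size_mkseq (subst_inf_word (dual_ncf_subst N d) w) i) E size_cat.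
  by rewrite size_dual_ncf_subst_prefix size_takel // ltnW.
split; first by exists m; rewrite // iE leq_addr.
case wm: (w m) r_lt; rewrite /= ?size_rcons size_nseq => r_lt.
  by exists m.+1; rewrite /len !prefix_countS wm /= ?addn0 // iE /len; lia.
by exists m; rewrite // iE leq_add2l.
Qed.

Lemma dual_window_balanced N C d w l : 0 < N -> 0 < d -> 0 < C ->
  N * C + d <= d.+1 * C ->
  (forall k, k < l -> window_balanced C k w) ->
  window_balanced C l (subst_inf_word (dual_ncf_subst N d) w).
Proof.
move=> N_gt0 d_gt0 C_gt0 NC wb i j; rewrite leqNgt; apply/negP => lt.
(* The window at [i] has too many ones: its ends are moved inwards, those of the window at [j]
   outwards, up to errors [d]. *)
have [_ [m1 Z1 L1]] := desubstitute_dual d w i N_gt0.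
have [[m2 Z2 L2] _] := desubstitute_dual d w (i + l) N_gt0.
have [[m3 Z3 L3] _] := desubstitute_dual d w j N_gt0.
have [_ [m4 Z4 L4]] := desubstitute_dual d w (j + l) N_gt0.
rewrite -Z1 -Z2 -Z3 -Z4 in lt.
set z := prefix_count false w in Z1 Z2 Z3 Z4 L1 L2 L3 L4 lt.
set o := prefix_count true w in L1 L2 L3 L4.
have zmono := @leq_prefix_count false w; have omono := @leq_prefix_count true w.
have z34 : z m3 <= z m4 by rewrite Z3 Z4 leq_prefix_count ?leq_addr.
have m12 : m1 <= m2 by case: leqP => // /ltnW/zmono; rewrite -/z; lia.
have o12 := omono _ _ m12; have z12 := zmono _ _ m12; rewrite -/o -/z in o12 z12.
have [a zE] : exists a, z m2 = z m1 + a by exists (z m2 - z m1); lia.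
have [b zE'] : exists b, z m4 = z m3 + b by exists (z m4 - z m3); lia.
have [s oE] : exists s, o m2 = o m1 + s by exists (o m2 - o m1); lia.
have inner : d.+1 * a + N * s <= l + d.
  by rewrite zE oE !mulnDr in L2; lia.
have ab : b + C < a by lia.
have abM : d.+1 * (b + C.+1) <= d.+1 * a by rewrite leq_mul2l; lia.
rewrite mulnDr mulnS in abM.
(* Otherwise [l <= d.+1 * b + N * (s + C) + d]; with [inner] and [abM] this gives (d+1)(C+1) <= NC +
   2d, against [NC]. *)
have ones : o m3 + s + C < o m4.
  rewrite ltnNge; apply/negP => le.
  have : N * o m4 <= N * (o m3 + s + C) by rewrite leq_mul2l le orbT.
  by rewrite zE' !mulnDr in L4 *; lia.
have m34 : m3 <= m4 by case: leqP => // /ltnW/omono; rewrite -/o; lia.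
(* The letters have exchanged roles, so the pair is swapped. The length below [l] is that of the
   inner preimage: [a >= 2] gives a + s <= l - d. *)
apply: (@unbalanced_pair C w l m3 m4 m1 m2) => //; rewrite -?/o -?/z; try lia.
right.
have da : d * 2 <= d * a by rewrite leq_mul2l; lia.
have sN : s <= N * s by rewrite leq_pmull.
have := prefix_count_bool w m1; have := prefix_count_bool w m2.
by rewrite -/o -/z; rewrite mulSn in inner; lia.
Qed.

Lemma s_adic_dual_window_balanced N C (d : nat -> nat) w : 0 < N -> 0 < C ->
  (forall n, 0 < d n) -> (forall n, N * C + d n <= (d n).+1 * C) ->
  is_s_adic_word (fun n => dual_ncf_subst N (d n)) w ->
  forall l, window_balanced C l w.
Proof.
(* The level is generalized before the induction on length, since windows at level [n] are
   controlled by shorter ones at level [n.+1]. *)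
move=> N_gt0 C_gt0 d_gt0 NC [ws [<- wsE]] l; move: 0.
elim/ltn_ind: l => l IH n; rewrite wsE.
by apply: dual_window_balanced => // k kl; apply: IH.
Qed.

(** * From the dual word to the NCF word *)

Definition blow_up (N : nat) : substitution :=
  fun a => if a then nseq N true else [:: false].

Lemma blow_up_gt0 N a : 0 < N -> 0 < size (blow_up N a).
Proof. by case: a; rewrite /= ?size_nseq. Qed.

Lemma ncf_subst_gt0 N d a : 0 < N -> 0 < size (ncf_subst N d a).
Proof. by case: a => //= N_gt0; rewrite size_cat !size_nseq addn_gt0 N_gt0 orbT. Qed.

(** Both sides are 0^d 1^N for the letter 0 and 0^N for the letter 1. *)
Lemma blow_up_dual_ncf_subst N d a :
  subst_word (blow_up N) (dual_ncf_subst N d a) =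
  subst_word (ncf_subst N d) (blow_up N a).
Proof.
have nseqE (s : substitution) b c : s b = [:: c] ->
    forall n, subst_word s (nseq n b) = nseq n c.
  by move=> sb; elim=> //= n; rewrite /subst_word /= sb => ->.
case: a; rewrite /dual_ncf_subst /=.
  by rewrite !(nseqE _ _ false).
by rewrite -cats1 subst_word_cat (nseqE _ _ false) // /subst_word /= !cats0.
Qed.

Lemma is_s_adic_blow_up N (d : nat -> nat) w : 0 < N ->
  is_s_adic_word (fun n => dual_ncf_subst N (d n)) w ->
  is_s_adic_word (fun n => ncf_subst N (d n)) (subst_inf_word (blow_up N) w).
Proof.
move=> N_gt0 [ws [<- wsE]].
exists (fun n => subst_inf_word (blow_up N) (ws n)); split=> // n.
rewrite wsE !subst_inf_word_comp => [|a|a|a|a];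
  rewrite ?blow_up_gt0 ?ncf_subst_gt0 ?dual_ncf_subst_gt0 //.
by congr subst_inf_word; apply/funext => a; apply: blow_up_dual_ncf_subst.
Qed.

Lemma count_blow_up_prefix N a w m :
  count_mem a (subst_word (blow_up N) (mkseq w m)) =
  (if a then N else 1) * prefix_count a w m.
Proof.
elim: m => [|m IH]; first by rewrite /prefix_count /= muln0.
rewrite mkseqS -cats1 subst_word_cat count_cat IH !prefix_countS mulnDr.
by congr (_ + _); case: (w m); case: a {IH};
  rewrite /subst_word /= ?cats0 ?count_nseq_bool; lia.
Qed.

(** A cut inside a block 1^N can be moved to either end of the block without crossing a 0. *)
Lemma desubstitute_blow_up N w i : 0 < N ->
  let nu := subst_inf_word (blow_up N) w in
  (exists2 m, prefix_count false w m = prefix_count false nu i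
            & N * prefix_count true w m <= prefix_count true nu i) /\
  (exists2 m, prefix_count false w m = prefix_count false nu i
            & prefix_count true nu i <= N * prefix_count true w m).
Proof.
move=> N_gt0 nu.
have [a|m [r [r_lt E]]] := @prefix_subst_inf_word (blow_up N) _ w i.
  exact: blow_up_gt0.
have nuE a : prefix_count a nu i =
    (if a then N else 1) * prefix_count a w m +
    count_mem a (take r (blow_up N (w m))).
  by rewrite /prefix_count E count_cat count_blow_up_prefix.
rewrite !nuE mul1n; case wm: (w m) r_lt => /=.
  rewrite size_nseq => rN; rewrite take_nseq ?(ltnW rN) // !count_nseq_bool /=.
  rewrite mul1n mul0n addn0.
  split; first by exists m; rewrite ?leq_addr.
  by exists m.+1; rewrite !prefix_countS wm ?addn0 //; lia.
by case: r {E nuE} => // _; split; exists m; rewrite ?addn0.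
Qed.

(** Extend the window with too many ones to whole blocks and shrink the other. An excess of ones
    above NC becomes one above C after division by [N], while the zeros, hence their excess above NC
    >= C, are unchanged. *)
Lemma blow_up_window_balanced N C w : 0 < N ->
  (forall l, window_balanced C l w) ->
  forall l, window_balanced (N * C) l (subst_inf_word (blow_up N) w).
Proof.
move=> N_gt0 wb l i j; rewrite leqNgt; apply/negP => lt.
have [[m1 Z1 O1] _] := desubstitute_blow_up w i N_gt0.
have [_ [m2 Z2 O2]] := desubstitute_blow_up w (i + l) N_gt0.
have [_ [m3 Z3 O3]] := desubstitute_blow_up w j N_gt0.
have [[m4 Z4 O4] _] := desubstitute_blow_up w (j + l) N_gt0.
have pc := prefix_count_bool (subst_inf_word (blow_up N) w).
have pci := pc i; have pcil := pc (i + l); have pcj := pc j; have pcjl := pc (j + l).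
have CN : C <= N * C by rewrite leq_pmull.
have zmono := @leq_prefix_count false w; have omono := @leq_prefix_count true w.
have z12 : prefix_count false w m1 <= prefix_count false w m2.
  by rewrite Z1 Z2 leq_prefix_count ?leq_addr.
have o34 := @leq_prefix_count true (subst_inf_word (blow_up N) w) _ _ (leq_addr l j).
have ones : prefix_count true w m4 + prefix_count true w m1 + C <
            prefix_count true w m2 + prefix_count true w m3.
  by rewrite -(ltn_pmul2l N_gt0) !mulnDr; lia.
have zeros : prefix_count false w m2 + prefix_count false w m3 + C <
             prefix_count false w m4 + prefix_count false w m1.
  by rewrite Z1 Z2 Z3 Z4; lia.
have m34 : m3 <= m4 by case: leqP => // /ltnW/zmono; lia.
have m12 : m1 <= m2.
  case: leqP => // /ltnW/omono; have := omono _ _ m34; lia.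
(* All lengths are balanced in [w], so the bound is just one more than the first length. *)
apply: (@unbalanced_pair C w (m2 - m1).+1 m1 m2 m3 m4) => //; by left.
Qed.

Theorem theorem4p4 (R : realType) (N K : nat)
    (N_ge1 : (1 <= N)%N) (K_geN : (N <= K)%N) :
  let C := ((K - 1) %/ (K + 1 - N) + 1)%N in
  (forall x : R, ncf_W N K x -> balanced C (dual_ncf_word N x)) /\
  (forall x : R, ncf_W N K x -> balanced (N * C)%N (ncf_word N x)).
Proof.
move=> C.
have C_gt0 : (0 < C)%N by rewrite /C addn1.
(* The choice of [C] as a floor plus one means K - 1 < C(K + 1 - N). *)
have NCK : (N * C + K <= K.+1 * C)%N.
  have := @ltn_ceil (K - 1) (K + 1 - N) ltac:(lia).
  by rewrite -addn1 -/C mulnC mulnBl addn1 mulSn => ?; lia.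
have dual_s_adic (x : R) : ncf_W N K x ->
    is_s_adic_word (fun n => dual_ncf_subst N `|ncf_digit N x n|%N)
                   (dual_ncf_word N x).
  by case=> x01 irx _; apply/dual_ncf_wordP.
have dual_balanced (x : R) : ncf_W N K x ->
    forall l, window_balanced C l (dual_ncf_word N x).
  move=> xW; have d_ge n : (K <= `|ncf_digit N x n|)%N.
    by case: xW => _ _ /(_ n); lia.
  apply: s_adic_dual_window_balanced (dual_s_adic x xW) => // n.
    by have := d_ge n; lia.
  (* Raising the digit from [K] by e adds e on the left and eC >= e on the right. *)
  rewrite -(subnKC (d_ge n)) -addSn mulnDl addnA leq_add //.
  exact: leq_pmulr.
split=> x xW; apply: balanced_windows; first exact: dual_balanced.
have [x01 irx _] := xW.
(* Uniqueness of the NCF sequence identifies it with the blown-up dual. *)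
have /(ncf_wordP N_ge1 _ x01 irx) <- := is_s_adic_blow_up N_ge1 (dual_s_adic x xW).
exact/blow_up_window_balanced/dual_balanced.
Qed.
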